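(* Let $k\ge 1$, let $0<r_1<\cdots<r_k$ be integers, let $d=\gcd(r_1,\ldots,r_k)$, and let $S=\langle r_1,\ldots,r_k\rangle$. Let $n$ be a positive integer with $\gcd(n,d)=1$, and let $M_n=\langle n,n+r_1,\ldots,n+r_k\rangle$. If $n>r_k^2$ and $dn\in S$, then $$\operatorname{Ap}(M_n)=\{\,i+\mathsf m_S(i)\cdot n \;:\; i\in\operatorname{Ap}(S;dn)\,\}.$$ Moreover, for each $i\in\operatorname{Ap}(S;dn)$, $$\mathsf L_{M_n}\bigl(i+\mathsf m_S(i)\cdot n\bigr)=\{\mathsf m_S(i)\}.$$
   Context: A numerical monoid is an additive submonoid of $\mathbb Z_{\ge 0}$ (not necessarily cofinite); $\langle g_1,\ldots,g_m\rangle$ denotes the submonoid of $\mathbb Z_{\ge0}$ generated by $g_1,\ldots,g_m$. For a numerical monoid $M$ and $x\in M$, the Apéry set of $x$ is $\operatorname{Ap}(M;x)=\{m\in M : m-x\in\mathbb Z\setminus M\}$, and $\operatorname{Ap}(M)=\operatorname{Ap}(M;n_1)$, where $n_1$ is the smallest nonzero element of $M$ (so $\operatorname{Ap}(M_n)=\operatorname{Ap}(M_n;n)$). For a numerical monoid $M=\langle g_1,\ldots,g_m\rangle$ with the given list of generators, a factorization of $a\in M$ is a tuple $(z_1,\ldots,z_m)\in\mathbb Z_{\ge0}^m$ with $a=z_1g_1+\cdots+z_mg_m$; its length is $z_1+\cdots+z_m$. $\mathsf L_M(a)$ is the set of lengths of factorizations of $a$, and $\mathsf m_M(a)=\min\mathsf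 L_M(a)$. Factorizations in $S$ are taken with respect to the list $r_1,\ldots,r_k$ (which need not be a minimal generating set), and factorizations in $M_n$ with respect to $n,n+r_1,\ldots,n+r_k$. *)

(* Defs.v *)
From mathcomp Require Import all_boot all_order all_algebra.
From mathcomp Require Import all_classical.
Set Implicit Arguments.
Unset Strict Implicit.
Unset Printing Implicit Defensive.
Local Open Scope classical_set_scope.

Definition numerical_monoid (M : set nat) : Prop :=
  M 0 /\ forall a b, M a -> M b -> M (a + b).

Definition monoid_gen m (g : m.-tuple nat) : set nat :=
  smallest numerical_monoid [set x | x \in g].

(* Junk value 0 on the empty set. *)
Definition min_of (A : set nat) : nat := xget 0 (A `&` lbound A).

(* The difference m - x is taken in int, since nat subtraction truncates. *)
Definition apery_at (M : set nat) (x : nat) : set nat :=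
  [set m | M m /\ ~ exists2 y : nat, M y & (m%:Z - x%:Z = y%:Z)%R].

Definition apery (M : set nat) : set nat := apery_at M (min_of (M `\ 0)).

Definition factorization m (g : m.-tuple nat) (a : nat) (z : m.-tuple nat) :
    Prop :=
  a = \sum_(i < m) tnth z i * tnth g i.

Definition fact_length m (z : m.-tuple nat) : nat := \sum_(i < m) tnth z i.

Definition length_set m (g : m.-tuple nat) (a : nat) : set nat :=
  [set fact_length z | z in factorization g a].

Definition min_length m (g : m.-tuple nat) (a : nat) : nat :=
  min_of (length_set g a).

Definition shifted k (n : nat) (r : k.-tuple nat) : k.+1.-tuple nat :=
  [tuple of n :: [seq n + x | x <- r]].

(* Main.v *)
Require Import Defs.
From mathcomp Require Import all_boot all_order all_algebra.
From mathcomp Require Import all_classical.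
From mathcomp Require Import zify.
Local Open Scope classical_set_scope.

(**
An element of $M_n$ with a factorization of length $L$ is exactly a number
$L n + s$ with $s \in S$ and $m_S(s) \le L$. By the pigeonhole principle, any
$r_k$ generators other than $r_k$ contain a nonempty block whose sum is a
multiple of $r_k$, and replacing it by copies of $r_k$ shortens a factorization. So a
factorization of minimal length has fewer than $r_k$ such generators, and
$s \le r_k m_S(s) \le s + r_k^2$. Since $n > r_k^2$, adding a positive multiple
of $dn$ to an element of $S$ strictly increases $m_S$. Two representations
$L n + s = L' n + s'$ satisfy $s \equiv s'$ modulo $dn$, so all comparisons reduce
to this monotonicity.
*)

(** * Minima, and factorizations as lists of generators *)

Lemma min_ofP (A : set nat) (x : nat) :
  A x -> A (min_of A) /\ forall y, A y -> min_of A <= y.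
Proof.
move=> Ax.
(* Well-ordering supplies a minimum, so the default value 0 of [min_of] does not arise. *)
have [m Am mlb] : exists2 m, A m & forall y, A y -> m <= y.
  have exA : exists m, `[< A m >] by exists x; apply/asboolP.
  exists (ex_minn exA); case: ex_minnP => m /asboolP Am m_min //.
  by move=> y Ay; apply/m_min/asboolP.
suff [? lbA] : (A `&` lbound A) (min_of A) by split=> // y /lbA.
by apply: (@xgetI _ _ _ m); split=> // y /mlb.
Qed.

(* A factorization, seen as the list of its generators with multiplicity. *)
Definition seq_fact (g l : seq nat) (a : nat) : Prop :=
  {subset l <= g} /\ sumn l = a.

Lemma seq_fact_tuple m (g z : m.-tuple nat) :
  exists2 l, seq_fact g l (\sum_(i < m) tnth z i * tnth g i)
           & size l = fact_length z.
Proof.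
exists (flatten [seq nseq (tnth z i) (tnth g i) | i <- enum 'I_m]).
  split.
    move=> x /flatten_mapP[i _] /nseqP[-> _]; exact: mem_tnth.
  rewrite sumn_flatten -map_comp sumnE big_map big_enum.
  by apply: eq_bigr => i _ /=; rewrite sumn_nseq mulnC.
rewrite size_flatten /shape -map_comp sumnE big_map big_enum.
by apply: eq_bigr => i _ /=; rewrite size_nseq.
Qed.

Lemma tuple_of_seq_fact m (g : m.-tuple nat) (l : seq nat) (a : nat) :
  seq_fact g l a -> exists2 z, factorization g a z & fact_length z = size l.
Proof.
elim: l a => [|x l IHl] a [lg <-].
  exists (nseq_tuple m 0); rewrite /factorization /fact_length.
    by rewrite big1 // => i _; rewrite tnth_nseq.
  by rewrite big1 // => i _; rewrite tnth_nseq.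
have [|z zl zs] := IHl (sumn l).
  by split=> // y yl; apply: lg; rewrite inE yl orbT.
have /tnthP[j xj] : x \in g by apply: lg; rewrite mem_head.
exists [tuple (i == j) + tnth z i | i < m]; rewrite /factorization /fact_length.
  under eq_bigr do rewrite tnth_mktuple mulnDl.
  rewrite big_split /= -zl (bigD1 j) //= eqxx mul1n -xj big1 ?addn0 //.
  by move=> i /negPf ->.
under eq_bigr do rewrite tnth_mktuple.
rewrite big_split /= -zs (bigD1 j) //= eqxx big1 // => i /negPf -> //.
Qed.

Lemma length_setE m (g : m.-tuple nat) (a L : nat) :
  length_set g a L <-> exists2 l, seq_fact g l a & size l = L.
Proof.
split=> [[z -> <-]|[l /tuple_of_seq_fact[z za zl] <-]].
  exact: seq_fact_tuple.
by exists z.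
Qed.

Lemma monoid_genE m (g : m.-tuple nat) (a : nat) :
  monoid_gen g a <-> exists l, seq_fact g l a.
Proof.
split.
  (* The sums of lists over [g] form a submonoid containing [g], so minimality of [monoid_gen]
     applies. *)
  move=> /(_ [set a | exists l, seq_fact g l a]); apply; split.
    split; first by exists [::].
    move=> b c [l1 [l1g <-]] [l2 [l2g <-]]; exists (l1 ++ l2).
    split; last exact: sumn_cat.
    by move=> x; rewrite mem_cat => /orP[/l1g|/l2g].
  move=> x /= xg; exists [:: x]; split; last exact: addn0.
  by move=> y; rewrite inE => /eqP ->.
move=> [l [+ <-]] M [[M0 MD] gM].
elim: l => [_|x l IHl lg] //=; apply: MD.
  by apply/gM/lg; rewrite mem_head.
by apply: IHl => y yl; apply: lg; rewrite inE yl orbT.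
Qed.

Lemma monoid_gen_min_length m (g : m.-tuple nat) (a : nat) :
  monoid_gen g a ->
  exists l, seq_fact g l a /\ size l = min_length g a.
Proof.
move=> /monoid_genE[l la].
have [|/length_setE[l' ? ?] _] := @min_ofP (length_set g a) (size l).
  by apply/length_setE; exists l.
by exists l'.
Qed.

Lemma min_length_le m (g : m.-tuple nat) (l : seq nat) (a : nat) :
  seq_fact g l a -> min_length g a <= size l.
Proof.
move=> la; have la' : length_set g a (size l) by apply/length_setE; exists l.
by have [_ ->] := min_ofP _ _ la'.
Qed.

Lemma monoid_genD m (g : m.-tuple nat) (a b : nat) :
  monoid_gen g a -> monoid_gen g b -> monoid_gen g (a + b).
Proof.
by move=> Ma Mb M MP; case: (MP) => -[_ MD] _; apply: MD; [apply: Ma|apply: Mb].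
Qed.

Lemma monoid_gen0 m (g : m.-tuple nat) : monoid_gen g 0.
Proof. by move=> M [[]]. Qed.

Lemma monoid_genMn m (g : m.-tuple nat) (a q : nat) :
  monoid_gen g a -> monoid_gen g (q * a).
Proof.
move=> ga; elim: q => [|q IHq]; first exact: monoid_gen0.
by rewrite mulSn; apply: monoid_genD.
Qed.

(** * Lengths of factorizations in $M_n$ *)

Lemma shifted_length_setE k (r : k.-tuple nat) (n a L : nat) :
  length_set (shifted n r) a L <->
  exists s, [/\ monoid_gen r s, min_length r s <= L & a = s + L * n].
Proof.
rewrite length_setE; split=> [[l la <-]|[s [Ss sL ->]]].
  (* Every generator contributes one [n]; dropping the copies of [n] itself and unshifting the rest
     leaves [l']. *)
  suff [l' [l'r sz ->]] : exists l', [/\ {subset l' <= r}, size l' <= size l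
      & a = sumn l' + size l * n].
    have l's : seq_fact r l' (sumn l') by [].
    exists (sumn l'); split=> //; first by apply/monoid_genE; exists l'.
    exact: leq_trans (min_length_le _ _ _ _ l's) sz.
  case: la => + <- {a}; elim: l => [_|x l IHl lg]; first by exists [::].
  have [|l' [l'r sz e]] := IHl.
    by move=> y yl; apply: lg; rewrite inE yl orbT.
  have : x \in shifted n r by apply: lg; rewrite mem_head.
  rewrite inE => /predU1P[->|/mapP[y yr ->]].
    by exists l'; split=> //=; [apply: leqW|rewrite mulSn e addnCA].
  exists (y :: l'); split=> //=; last by rewrite e mulSn; lia.
  by move=> t; rewrite inE => /predU1P[->|/l'r].
have [l [[lr ls] sz]] := monoid_gen_min_length _ _ _ Ss.
(* Shift a shortest factorization of [s], then pad with copies of [n] up to length [L]. *)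
exists ([seq n + x | x <- l] ++ nseq (L - size l) n); last first.
  by rewrite size_cat size_map size_nseq; lia.
split.
  move=> x; rewrite mem_cat inE => /orP[/mapP[y yl ->]|/nseqP[-> _]].
    by rewrite map_f ?orbT // lr.
  by rewrite eqxx.
have smE : sumn [seq n + x | x <- l] = size l * n + s.
  by rewrite -ls; elim: (l) => //= y t ->; rewrite mulSn; lia.
rewrite -sz in sL; rewrite sumn_cat sumn_nseq smE -{2}(subnKC sL).
by rewrite mulnDl [n * _]mulnC; lia.
Qed.

(** * Shortening factorizations by zero-sum blocks *)

Lemma zero_sum_block (m : nat) (p : seq nat) :
  0 < m <= size p ->
  exists p1 p2 p3, [/\ p = p1 ++ p2 ++ p3, 0 < size p2 & m %| sumn p2].
Proof.
move=> /andP[m0 mp].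
(* The [m.+1] prefixes of lengths 0 to [m] have sums in only [m] residue classes; two that agree
   differ by the block. *)
pose f (i : 'I_m.+1) : 'I_m := Ordinal (ltn_pmod (sumn (take i p)) m0).
have /injectivePn[i [j]] : ~~ injectiveb f.
  by apply/injectiveP => /leq_card; rewrite !card_ord ltnn.
wlog ij : i j / i < j => [th nij fij|_ /(congr1 val) /= /eqP fij].
  have := nij; rewrite -val_eqE neq_ltn => /orP[ij|ji]; first exact: (th i j).
  by apply: (th j i) => //; rewrite eq_sym.
have jp : j <= size p by rewrite (leq_trans _ mp) // -ltnS.
have takeE : take j p = take i p ++ drop i (take j p).
  by rewrite -{1}(cat_take_drop i (take j p)) take_takel // ltnW.
exists (take i p), (drop i (take j p)), (drop j p); split.
- by rewrite catA -takeE cat_take_drop.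
- by rewrite size_drop size_takel // subn_gt0.
- move: fij; rewrite {1}takeE sumn_cat eq_sym eqn_mod_dvd ?leq_addr //.
  by rewrite addKn.
Qed.

Lemma sumn_lt_size (m : nat) (l : seq nat) :
  0 < size l -> {in l, forall x, x < m} -> sumn l < size l * m.
Proof.
elim: l => [|x [|y l] IHl] //= _ lm.
  by rewrite addn0 mul1n lm ?mem_head.
have /= := IHl isT (fun z zl => lm z (@mem_behead _ [:: x, y & l] z zl)).
by have := lm x (mem_head _ _); rewrite !mulSn; lia.
Qed.

(** Here [c] counts the copies of [m] and [p] lists the smaller generators. Trading a block of sum
    [q * m] for [q] copies of [m] shortens [p], which drives the induction. *)
Lemma shorten_small (m c : nat) (p : seq nat) :
  0 < m -> {in p, forall x, x < m} ->
  exists p' c', [/\ {subset p' <= p}, size p' < m,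
    size p' + c' <= size p + c & sumn p' + c' * m = sumn p + c * m].
Proof.
move=> m0; have [s] := ubnP (size p).
elim: s p c => // s IHs p c; rewrite ltnS => ps pm.
have [|mp] := ltnP (size p) m; first by exists p, c; split.
have [|p1 [p2 [p3 [pE p20 /dvdnP[q p2q]]]]] := @zero_sum_block m p.
  by rewrite m0.
(* Entries below [m] force the block to have more than [q] terms, so the trade lowers the total
   length. *)
have p2m : sumn p2 < size p2 * m.
  by apply: sumn_lt_size => // x xp; rewrite pm // pE !mem_cat xp orbT.
have q2 : q < size p2 by rewrite -(@ltn_pmul2r m) // -p2q.
have sub : {subset p1 ++ p3 <= p}.
  by move=> x; rewrite pE !mem_cat => /orP[->|->]; rewrite ?orbT.
have sz : size p = size (p1 ++ p3) + size p2.
  by rewrite pE !size_cat; lia.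
have [||p' [c' [p'p ? ? e]]] := IHs (p1 ++ p3) (c + q).
- by rewrite sz in ps; lia.
- by move=> x /sub /pm.
exists p', c'; split=> //.
- by move=> x /p'p /sub.
- by lia.
- by rewrite e pE !sumn_cat p2q; nia.
Qed.

Lemma shorten_fact (m : nat) (l : seq nat) :
  0 < m -> {in l, forall x, x <= m} ->
  exists l', [/\ {subset l' <= m :: l}, sumn l' = sumn l, size l' <= size l
    & size l' * m <= sumn l + m ^ 2].
Proof.
move=> m0 lm.
have lE := permEl (perm_filterC (pred1 m) l).
have mE : [seq x <- l | pred1 m x] = nseq (count_mem m l) m.
  by rewrite -size_filter; apply/all_pred1P; apply: filter_all.
have [|p [c [pl pm sz e]]] :=
    @shorten_small m (count_mem m l) [seq x <- l | predC (pred1 m) x] m0.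
  by move=> x; rewrite mem_filter /= => /andP[xm /lm]; rewrite ltn_neqAle xm.
have := perm_size lE; rewrite mE size_cat size_nseq => szE.
have := perm_sumn lE; rewrite mE sumn_cat sumn_nseq => smE.
exists (p ++ nseq c m); split.
- move=> x; rewrite mem_cat inE => /orP[/pl|/nseqP[-> _]]; rewrite ?eqxx //.
  by rewrite mem_filter => /andP[_ ->]; rewrite orbT.
- by rewrite sumn_cat sumn_nseq mulnC e addnC mulnC smE.
- by rewrite size_cat size_nseq -szE (leq_trans sz) // addnC.
(* The copies of [m] are paid for by the sum itself; the fewer than [m] other terms cost at most
   [m ^ 2]. *)
- rewrite size_cat size_nseq -smE [m * _]mulnC [_ * m + sumn _]addnC -e.
  rewrite mulnDl -mulnn addnAC leq_add2r.
  by rewrite addnC (leq_trans _ (leq_addr _ _)) // leq_mul2r ltnW ?orbT.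
Qed.

(** * Bounds on the minimal length *)

Lemma min_length_ge k (r : k.-tuple nat) (m s : nat) :
  {in r, forall x, x <= m} -> monoid_gen r s -> s <= min_length r s * m.
Proof.
move=> rm Ss.
have [l [[lr <-] <-]] := monoid_gen_min_length _ _ _ Ss.
elim: l lr => //= x l IHl lr; rewrite mulSn leq_add //.
  by rewrite rm ?lr ?mem_head.
by apply: IHl => y yl; rewrite lr // inE yl orbT.
Qed.

Lemma min_length_mul_le k (r : k.-tuple nat) (m s : nat) :
  0 < m -> m \in r -> {in r, forall x, x <= m} -> monoid_gen r s ->
  min_length r s * m <= s + m ^ 2.
Proof.
move=> m0 mr rm /monoid_genE[l [lr <-]].
have [|l' [l'r sl' _ sz]] := @shorten_fact _ l m0; first by move=> x /lr /rm.
apply: leq_trans sz; rewrite leq_mul2r min_length_le ?orbT //; split=> // x.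
by move=> /l'r; rewrite inE => /predU1P[->|/lr].
Qed.

(** After multiplication by [m], the two lengths are separated by [s + m ^ 2 < s + t]. *)
Lemma min_length_lt_add k (r : k.-tuple nat) (m s t : nat) :
  0 < m -> m \in r -> {in r, forall x, x <= m} ->
  monoid_gen r s -> monoid_gen r (s + t) -> m ^ 2 < t ->
  min_length r s < min_length r (s + t).
Proof.
move=> m0 mr rm Ss Sst mt; rewrite -(ltn_pmul2r m0).
apply: leq_ltn_trans (min_length_mul_le _ _ _ _ m0 mr rm Ss) _.
apply: leq_trans (min_length_ge _ _ _ _ rm Sst).
by rewrite ltn_add2l.
Qed.

(** * Apéry sets and the proof of the theorem *)

Lemma apery_atE (M : set nat) (x m : nat) :
  apery_at M x m <-> M m /\ ~ exists2 y, M y & m = y + x.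
Proof.
split=> -[Mm nM]; split=> // -[y My e]; apply: nM; exists y => //; lia.
Qed.

Lemma dvdn_monoid_gen k (r : k.-tuple nat) (s : nat) :
  monoid_gen r s -> \big[gcdn/0]_(i < k) tnth r i %| s.
Proof.
move=> /monoid_genE[l [lr <-]]; elim: l lr => //= x l IHl lr.
have /tnthP[i ->] : x \in r by rewrite lr ?mem_head.
apply: dvdn_add; first exact: (biggcdn_inf i).
by apply: IHl => y yl; rewrite lr // inE yl orbT.
Qed.

Lemma min_of_shifted k (r : k.-tuple nat) (n : nat) :
  0 < n -> min_of (monoid_gen (shifted n r) `\ 0) = n.
Proof.
move=> n0.
have nM : (monoid_gen (shifted n r) `\ 0) n.
  split; last by move=> /= n0'; rewrite n0' in n0.
  apply/monoid_genE; exists [:: n].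
  by split=> [x|]; rewrite ?inE /= ?addn0 // => ->.
have [[/monoid_genE[l [lr le]] z] lb] := min_ofP _ _ nM.
apply/eqP; rewrite eqn_leq lb //=; move: z; rewrite -le.
case: l lr {le} => //= x l lr _; apply: leq_trans (leq_addr _ _).
have : x \in shifted n r by rewrite lr ?mem_head.
by rewrite inE => /predU1P[->|/mapP[y _ ->]] //; apply: leq_addr.
Qed.

Theorem theorem3p3 (k : nat) (r : k.-tuple nat) (n : nat)
    (hk : 0 < k) (hr : sorted ltn (0 :: r)) (hn0 : 0 < n) :
  let d := \big[gcdn/0]_(i < k) tnth r i in
  let S := monoid_gen r in
  let Mn := monoid_gen (shifted n r) in
  gcdn n d = 1 ->
  (last 0 r) ^ 2 < n ->
  S (d * n) ->
  apery Mn = [set i + min_length r i * n | i in apery_at S (d * n)] /\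
  (forall i, apery_at S (d * n) i ->
     length_set (shifted n r) (i + min_length r i * n) = [set min_length r i]).
Proof.
move=> d S Mn nd rn Sdn.
set m := last 0 r in rn.
have mr : m \in r.
  have : 0 < size r by rewrite size_tuple.
  rewrite /m -[_ \in r]/(_ \in tval r); case: (tval r) => // x s _.
  exact: mem_last.
have rm : {in r, forall x, 0 < x <= m}.
  move=> x xr; have /= := hr.
  rewrite (path_sortedE ltn_trans) => /andP[/allP/(_ _ xr) -> srt].
  have := sorted_leq_nth leq_trans leqnn 0 (sub_sorted ltnW srt).
  move=> /(_ (index x r) (size r).-1); rewrite nth_last nth_index // !inE index_mem.
  have := index_mem x r; rewrite xr; move: (index x r) (size r) => a b ab.
  by apply => //; lia.
have m0 : 0 < m by have /andP[] := rm _ mr.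
have {}rm : {in r, forall x, x <= m} by move=> x /rm /andP[].
have d0 : 0 < d.
  apply: (dvdn_gt0 m0); apply/dvdn_monoid_gen/monoid_genE; exists [:: m].
  by split=> [x|]; rewrite ?inE /= ?addn0 // => /eqP ->.
(* Since [d] is positive, [q * (d * n)] is at least [n], hence exceeds [m ^ 2]. *)
have lt_shift s q : 0 < q -> S s ->
    min_length r s < min_length r (s + q * (d * n)).
  move=> q0 Ss; apply: (min_length_lt_add _ _ m) => //.
    by apply: monoid_genD => //; apply: monoid_genMn.
  by rewrite (leq_trans rn) // mulnA leq_pmull // muln_gt0 q0.
have rep_uniq i s L : apery_at S (d * n) i -> S s -> min_length r s <= L ->
    i + min_length r i * n = s + L * n -> s = i.
  move=> /apery_atE[Si nSi] Ss sL e.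
  have dvd_sub a b A B : S a -> S b -> a + A * n = b + B * n -> a <= b ->
      exists q, b = a + q * (d * n).
    move=> Sa Sb ab le_ab.
    suff /dvdnP[q qE] : d * n %| b - a by exists q; lia.
    (* Divisibility by [d] holds because both numbers lie in [S], divisibility by [n] follows from
       the equation, and [n] and [d] are coprime. *)
    rewrite Gauss_dvd; last by rewrite coprime_sym /coprime nd.
    rewrite dvdn_sub ?dvdn_monoid_gen //=.
    by apply/dvdnP; exists (A - B); rewrite mulnBl; lia.
  case: (ltngtP s i) => // [si|is_].
    (* If [s < i], then [i - d * n] would be [s] plus a multiple of [d * n], hence in [S]. *)
    have [[|q] iE] := dvd_sub s i _ _ Ss Si (esym e) (ltnW si); first by lia.
    case: nSi; exists (s + q * (d * n)); last by lia.
    by apply: monoid_genD => //; apply: monoid_genMn.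
  (* If [s > i], the equation forces [L] below [min_length r i], while monotonicity puts
     [min_length r s], and so [L], above it. *)
  have [[|q] sE] := dvd_sub i s _ _ Si Ss e (ltnW is_); first by lia.
  have := lt_shift i q.+1 isT Si; rewrite -sE.
  by nia.
have inM a : Mn a <-> exists L s, [/\ S s, min_length r s <= L & a = s + L * n].
  split=> [/monoid_gen_min_length[l [la sz]]|[L sP]].
    have /shifted_length_setE[s sP] : length_set (shifted n r) a (size l).
      by apply/length_setE; exists l.
    by exists (size l), s.
  have /length_setE[l la _] : length_set (shifted n r) a L.
    by apply/shifted_length_setE.
  by apply/monoid_genE; exists l.
split; last first.
  move=> i iA; apply/seteqP; split=> L /=.
    move=> /shifted_length_setE[s [Ss sL e]].
    have si := rep_uniq _ _ _ iA Ss sL e; rewrite si in e.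
    by nia.
  move=> ->; apply/shifted_length_setE; exists i; split=> //.
  by case: iA.
rewrite /apery min_of_shifted //; apply/seteqP; split=> a /=.
  move=> /apery_atE[/inM[L [s [Ss sL aE]]] na].
  (* A spare copy of [n] could be removed, leaving [a - n] in [Mn]. *)
  have LE : L = min_length r s.
    apply/eqP; rewrite eqn_leq sL andbT leqNgt; apply/negP => ltL.
    apply: na; exists (s + L.-1 * n); last by nia.
    by apply/inM; exists L.-1, s; split=> //; lia.
  exists s; last by rewrite aE LE.
  apply/apery_atE; split=> // -[t St sE]; apply: na.
  have := lt_shift t 1 isT St; rewrite mul1n -sE => ts.
  (* If [s = t + d * n], the part [d * n] becomes [d] further copies of [n], one of which is
     removed; [ts] leaves room for this. *)
  exists (t + (L + d).-1 * n); last by nia.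
  by apply/inM; exists (L + d).-1, t; split=> //; lia.
move=> [i iA <-]; have [Si _] := iA; apply/apery_atE; split.
  by apply/inM; exists (min_length r i), i.
move=> [_ /inM[L [s [Ss sL ->]]] e].
(* Adding [n] back gives a representation of length [L.+1]. Once [s = i], this length must equal
   [min_length r i], which is at most [L]. *)
have si : s = i by apply: (rep_uniq _ _ L.+1 iA Ss); [exact: ltnW|lia].
by rewrite si in sL e; nia.
Qed.
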